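(* Let $(R,\triangleright)$ be a finite rack. Then: (1) The intersection of all maximal subracks of $R$ is empty. (2) For any two subracks $Q_1$ and $Q_2$ of $R$, letting $T=\ll Q_1,Q_2\gg$ be the subrack of $R$ generated by $Q_1\cup Q_2$, the subrack $Q_1$ has a complement in the lattice $\mathcal{R}(T)$ of subracks of $T$ which is a subset of $Q_2$; that is, there is a subrack $Q\subseteq Q_2$ with $Q_1\cap Q=\emptyset$ and $\ll Q_1, Q\gg = T$.
   Context: A rack is a set $R$ with a binary operation $\triangleright$ such that $a\triangleright(b\triangleright c)=(a\triangleright b)\triangleright(a\triangleright c)$ for all $a,b,c\in R$, and for all $a,b\in R$ there is a unique $x\in R$ with $a\triangleright x=b$. A subrack of $R$ is a subset $Q\subseteq R$ such that $(Q,\triangleright)$ is itself a rack (the empty set is a subrack). For $S\subseteq R$, $\ll S\gg$ denotes the intersection of all subracks of $R$ containing $S$. The set $\mathcal{R}(R)$ of all subracks of $R$, ordered by inclusion, is a lattice with meet the intersection and join $Q\vee Q'=\ll Q\cup Q'\gg$; its least element is $\emptyset$ and greatest element is $R$. A complement of $Q$ in $\mathcal{R}(T)$ is a subrack $Q'$ of $T$ with $Q\cap Q'=\emptyset$ and $\ll Q\cup Q'\gg=T$. A maximal subrack of $R$ is a proper subrack of $R$ maximal under inclusion among proper subracks; the intersection of the empty family of subsets of $R$ is taken to be $R$. *)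

(* Defs.v *)
From HB Require Import structures.
From mathcomp Require Import all_boot.

Set Implicit Arguments.
Unset Strict Implicit.
Unset Printing Implicit Defensive.

Reserved Notation "a |> b" (at level 40, left associativity).

HB.mixin Record isRack R := {
  rack_op : R -> R -> R;
  rack_opD : forall a b c : R,
    rack_op a (rack_op b c) = rack_op (rack_op a b) (rack_op a c);
  rack_op_uniq : forall a b : R, exists! x : R, rack_op a x = b
}.

#[short(type="rackType")]
HB.structure Definition Rack := { R of isRack R }.

#[short(type="finRackType")]
HB.structure Definition FinRack := { R of isRack R & Finite R }.

Declare Scope rack_scope.
Notation "a |> b" := (rack_op a b) : rack_scope.
Local Open Scope rack_scope.

(* The three clauses say that [|>] restricts to an operation on Q, and that
   this restriction satisfies the two rack axioms; note that the solution of
   [a |> x = b] is sought in Q. The set Q may be empty. *)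
Definition subrack (R : finRackType) (Q : {set R}) : bool :=
  [&& [forall a in Q, forall b in Q, a |> b \in Q],
      [forall a in Q, forall b in Q, forall c in Q,
         a |> (b |> c) == (a |> b) |> (a |> c)]
    & [forall a in Q, forall b in Q, #|[set x in Q | a |> x == b]| == 1]].

Lemma subrackP (R : finRackType) (Q : {set R}) :
  reflect [/\ {in Q &, forall a b, a |> b \in Q},
              {in Q & &, forall a b c, a |> (b |> c) = (a |> b) |> (a |> c)}
            & {in Q &, forall a b, exists! x, x \in Q /\ a |> x = b}]
          (subrack Q).
Proof.
apply: (iffP and3P) => -[H1 H2 H3]; split.
- by move=> a b aQ bQ; move/forall_inP: H1 => /(_ a aQ) /forall_inP; apply.
- by move=> a b c *; apply: rack_opD.
- move=> a b aQ bQ; move/forall_inP: H3 => /(_ a aQ) /forall_inP /(_ b bQ).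
  case/cards1P=> x Ex; exists x; split.
    by have := set11 x; rewrite -Ex inE => /andP[-> /eqP].
  move=> y [yQ /eqP ayb]; apply/esym/eqP.
  by rewrite -in_set1 -Ex inE yQ.
- by apply/forall_inP => a aQ; apply/forall_inP => b bQ; apply: H1.
- apply/forall_inP => a aQ; apply/forall_inP => b bQ.
  by apply/forall_inP => c cQ; apply/eqP/H2.
- apply/forall_inP => a aQ; apply/forall_inP => b bQ; apply/cards1P.
  have [x [[xQ axb] xU]] := H3 a b aQ bQ; exists x; apply/setP => y.
  rewrite !inE; apply/andP/eqP => [[yQ /eqP ayb]|->]; first exact/esym/xU.
  by split=> //; apply/eqP.
Qed.

Definition rack_gen (R : finRackType) (S : {set R}) : {set R} :=
  \bigcap_(Q : {set R} | subrack Q && (S \subset Q)) Q.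

Definition maximal_subrack (R : finRackType) (M : {set R}) : bool :=
  maxset (fun Q : {set R} => subrack Q && (Q \proper [set: R])) M.

(* Q' is a complement of Q in the lattice of subracks of T. For Q, Q' included
   in a subrack T, every subrack of T is a subrack of R, so the join in that
   lattice is the subrack of R generated by the union. *)
Definition subrack_complement (R : finRackType) (T Q Q' : {set R}) : Prop :=
  [/\ subrack Q', Q' \subset T, Q :&: Q' = set0 & rack_gen (Q :|: Q') = T].

(* Main.v *)
(** The maximal subracks of a subrack [Q] are permuted by the left
multiplications by elements of [Q], so the complement in [Q] of their
intersection [F] is again a subrack. If [F] were nonempty, that complement would
lie in a maximal subrack, which also contains [F] and hence is all of [Q].
For (2), choose [Q \subset Q2] minimal with [Q1] and [Q] generating [T]. If [x]
were in both, a maximal subrack of [Q] avoiding [x] would, together with [x] and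
so with [Q1], generate [Q], contradicting minimality. *)
Require Import Defs.
From HB Require Import structures.
From mathcomp Require Import all_boot.

Set Implicit Arguments.
Unset Strict Implicit.
Unset Printing Implicit Defensive.

Local Open Scope rack_scope.

Lemma rack_op_inj (R : rackType) (a : R) : injective (rack_op a).
Proof.
move=> x y axy; have [z [_ zU]] := rack_op_uniq a (a |> y).
by rewrite -(zU x axy) (zU y).
Qed.

Section Subracks.
Variable R : finRackType.
Implicit Types (P Q M S : {set R}) (a x : R).

(** The image lies in [Q] and, by injectivity, has the same finite cardinality. *)
Lemma rack_op_imset_closed Q a :
  {in Q, forall b, a |> b \in Q} -> rack_op a @: Q = Q.
Proof.
move=> aQ; apply/eqP; rewrite eqEcard card_imset ?leqnn ?andbT.
  by apply/subsetP => _ /imsetP[b bQ ->]; apply: aQ.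
exact: rack_op_inj.
Qed.

(** By finiteness, left multiplication by an element of a closed [Q] maps [Q] onto itself, so
    equations are solvable inside [Q]. *)
Lemma subrack_closedP Q :
  reflect {in Q &, forall a b, a |> b \in Q} (subrack Q).
Proof.
apply: (iffP (subrackP Q)) => [[]//|cQ]; split=> // [a b c _ _ _|a b aQ bQ].
  exact: rack_opD.
have := bQ; rewrite -{1}(@rack_op_imset_closed Q a) => [|c]; last exact: cQ.
case/imsetP=> x xQ ->; exists x; split=> // y [_ /rack_op_inj-> //].
Qed.

Lemma subrack_imset Q a : subrack Q -> a \in Q -> rack_op a @: Q = Q.
Proof.
move=> /subrack_closedP cQ aQ.
by apply: rack_op_imset_closed => b; apply: cQ.
Qed.

Lemma subrack_op_mem Q a x :
  subrack Q -> a \in Q -> (a |> x \in Q) = (x \in Q).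
Proof.
move=> sQ aQ; rewrite -{1}(subrack_imset sQ aQ) mem_imset //.
exact: rack_op_inj.
Qed.

Lemma subrack_rack_gen S : subrack (rack_gen S).
Proof.
apply/subrack_closedP => a b /bigcapP aS /bigcapP bS; apply/bigcapP => Q PQ.
by case/andP: (PQ) => /subrack_closedP cQ _; apply: cQ; [apply: aS|apply: bS].
Qed.

Lemma sub_rack_gen S : S \subset rack_gen S.
Proof. by apply/bigcapsP => Q /andP[]. Qed.

Lemma rack_gen_sub S Q : subrack Q -> (rack_gen S \subset Q) = (S \subset Q).
Proof.
move=> sQ; apply/idP/idP => [|SQ]; first exact/subset_trans/sub_rack_gen.
by apply: bigcap_inf; rewrite sQ.
Qed.

(** Relative form of [maximal_subrack], to which it unfolds when [Q] is the whole rack. *)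
Definition maximal_subrack_in Q M :=
  maxset (fun P : {set R} => subrack P && (P \proper Q)) M.

(** By self-distributivity, left multiplication by [a] is an automorphism of the rack, and it maps
    [Q] onto itself. *)
Lemma maximal_subrack_in_op Q M a :
  subrack Q -> a \in Q -> maximal_subrack_in Q M ->
  maximal_subrack_in Q (rack_op a @: M).
Proof.
move=> sQ aQ /maxsetP[/andP[sM ltMQ] maxM]; apply/maxsetP; split=> [|P].
  apply/andP; split.
    apply/subrack_closedP => _ _ /imsetP[b bM ->] /imsetP[c cM ->].
    by rewrite -rack_opD imset_f // subrack_op_mem.
  rewrite properEcard -{1}(subrack_imset sQ aQ) imsetS ?(proper_sub ltMQ) //.
  by rewrite card_imset ?proper_card //; apply: rack_op_inj.
case/andP=> /subrack_closedP cP ltPQ aMP.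
(* Maximality of [M] will be applied to the preimage of [P], which contains [M]. *)
have eP : rack_op a @: (rack_op a @^-1: P) = P.
  apply/setP => y; apply/imsetP/idP => [[x + ->]|yP]; first by rewrite inE.
  have : y \in Q := subsetP (proper_sub ltPQ) y yP.
  rewrite -(subrack_imset sQ aQ) => /imsetP[x _ yE].
  by exists x; rewrite ?inE -?yE.
rewrite -[LHS]eP (maxM (rack_op a @^-1: P)) // -?sub_imset_pre //.
apply/andP; split.
  by apply/subrack_closedP => b c; rewrite !inE rack_opD; apply: cP.
rewrite properEcard -(card_imset _ (@rack_op_inj R a)) eP proper_card // andbT.
apply/subsetP => x; rewrite inE => axP.
by rewrite -(subrack_op_mem _ sQ aQ) (subsetP (proper_sub ltPQ)).
Qed.

Lemma maximal_subrack_avoiding Q x :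
  subrack Q -> x \in Q -> exists2 M, maximal_subrack_in Q M & x \notin M.
Proof.
move=> sQ xQ; apply/exists_inP; apply: contraT => noM.
pose N := [set y in Q | [exists M in maximal_subrack_in Q, y \notin M]].
have sN : subrack N.
  apply/subrack_closedP => a b /setIdP[aQ _] /setIdP[bQ /exists_inP[M mM bM]].
  rewrite inE subrack_op_mem // bQ; apply/exists_inP.
  (* If [M] misses [b], its translate by [a] misses [a |> b]. *)
  exists (rack_op a @: M); first exact: maximal_subrack_in_op.
  by rewrite mem_imset //; apply: rack_op_inj.
have ltNQ : N \proper Q.
  apply/properP; split; first by apply/subsetP => y /setIdP[].
  by exists x => //; rewrite inE xQ.
have [|M mM NM] := @maxset_exists _ (fun P => subrack P && (P \proper Q)) N.
  by rewrite sN.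
(* A point [y] of [Q] outside [M] is in [N] by definition, yet [N] lies in [M]. *)
have /maxsetP[/andP[_ /properP[_ [y yQ yM]]] _] := mM.
case/negP: (yM); apply: (subsetP NM); rewrite inE yQ.
by apply/exists_inP; exists M.
Qed.

(** The subrack [S :&: Q] of [Q] contains [M] and also [x], so by maximality of [M] it cannot be
    proper in [Q]. *)
Lemma maximal_subrack_in_gen Q M S x :
  subrack S -> subrack Q -> maximal_subrack_in Q M -> x \in Q -> x \notin M ->
  M \subset S -> x \in S -> Q \subset S.
Proof.
move=> /subrack_closedP cS /subrack_closedP cQ.
case/maxsetP=> /andP[_ ltMQ] maxM xQ xM MS xS.
apply/setIidPr/eqP; rewrite eqEsubset subsetIr /=; apply: contraT => nQ.
case/negP: xM; rewrite -(maxM (S :&: Q)) ?inE ?xS //.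
  rewrite properE subsetIr nQ !andbT; apply/subrack_closedP => a b.
  by move=> /setIP[aS aQ] /setIP[bS bQ]; rewrite inE cS ?cQ.
by rewrite subsetI MS proper_sub.
Qed.

Lemma subrack_complement_exists Q1 Q2 : subrack Q2 ->
  exists Q, Q \subset Q2 /\ subrack_complement (rack_gen (Q1 :|: Q2)) Q1 Q.
Proof.
move=> sQ2; set T := rack_gen _.
(* For [P] inside [Q2] the inclusion says that [Q1] and [P] generate [T]. *)
pose generating P := subrack P && (Q2 \subset rack_gen (Q1 :|: P)).
have [|Q] := @minset_exists _ generating Q2; rewrite /generating.
  by rewrite sQ2 (subset_trans _ (sub_rack_gen _)) ?subsetUr.
case/minsetP=> /andP[sQ genQ] minQ QQ2; exists Q; split=> //; split=> //.
- apply: subset_trans (subset_trans QQ2 _) (sub_rack_gen _).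
  exact: subsetUr.
- apply/eqP/set0Pn => -[x /setIP[xQ1 xQ]].
  have [M mM xM] := maximal_subrack_avoiding sQ xQ.
  have /maxsetP[/andP[sM ltMQ] _] := mM.
  set S := rack_gen (Q1 :|: M).
  have /subUsetP[Q1S MS] : Q1 :|: M \subset S := sub_rack_gen _.
  have sS : subrack S := subrack_rack_gen _.
  have QS : Q \subset S.
    exact: maximal_subrack_in_gen mM xQ xM MS (subsetP Q1S x xQ1).
  (* [M] is generating as well, so minimality forces [M = Q], which contains [x]. *)
  case/negP: xM; rewrite (minQ M) ?(proper_sub ltMQ) // sM /=.
  by apply: subset_trans genQ _; rewrite rack_gen_sub // subUset Q1S.
have /subUsetP[Q1gen _] := sub_rack_gen (Q1 :|: Q).
apply/eqP; rewrite eqEsubset; apply/andP; split.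
  rewrite rack_gen_sub ?subrack_rack_gen //.
  exact: subset_trans (setUS _ QQ2) (sub_rack_gen _).
by rewrite rack_gen_sub ?subrack_rack_gen // subUset Q1gen.
Qed.

End Subracks.

Theorem theorem3p1 (R : finRackType) :
  \bigcap_(M : {set R} | maximal_subrack M) M = set0 /\
  (forall Q1 Q2 : {set R}, subrack Q1 -> subrack Q2 ->
     exists Q : {set R},
       Q \subset Q2 /\ subrack_complement (rack_gen (Q1 :|: Q2)) Q1 Q).
Proof.
split=> [|Q1 Q2 _]; last exact: subrack_complement_exists.
apply/eqP/set0Pn => -[x /bigcapP xF].
have sT : subrack [set: R] by apply/subrack_closedP => a b; rewrite !inE.
have [M mM /negP[]] := maximal_subrack_avoiding sT (in_setT x).
exact: xF.
Qed.
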